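(* Let $J_0\in\mathbb N_0$ and let $J\ge J_0$ and $L\geq 0$ be integers. Let $K_\alpha=L+q_\alpha>J$, and suppose that $0\le\varepsilon<1$ and $$(1-\varepsilon)\|P\|_{L^2(\mu)}^2\le\|\mathcal B_{J,L}P\|_2^2\le(1+\varepsilon)\|P\|_{L^2(\mu)}^2,\qquad P\in\mathbb P_{2^L},$$ where $q_\alpha$ and the restricted analysis map $\mathcal B_{J,L}$ are defined in the context. For $f\in L^2(\mathcal M,\mu)$, let $f_L:=\sum_{\lambda_\ell\le2^L}\widehat f_\ell u_\ell$ be its $L^2(\mu)$-orthogonal projection onto $\mathbb P_{2^L}$, and let $$\mathbf c=\mathcal B_{J,L}f_L+\mathbf e,$$ where $\mathbf e$ is an arbitrary element of the codomain of $\mathcal B_{J,L}$. Define the one-pass reconstruction $\widetilde f_L:=\mathcal B_{J,L}^*\mathbf c$ and the canonical reconstruction $$u_L:=\operatorname*{argmin}_{P\in\mathbb P_{2^L}}\|\mathcal B_{J,L}P-\mathbf c\|_2^2.$$ Then $$\|\widetilde f_L-f\|_{L^2(\mu)}\le\|f-f_L\|_{L^2(\mu)}+\varepsilon\|f_L\|_{L^2(\mu)}+(1+\varepsilon)^{1/2}\|\mathbf e\|_2$$ and $$\|u_L-f\|_{L^2(\mu)}\le\|f-f_L\|_{L^2(\mu)}+\frac{1}{\sqrt{1-\varepsilon}}\|\mathbf e\|_2.$$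
   Context: $(\mathcal M,g)$ is a compact, connected, $d$-dimensional smooth Riemannian manifold without boundary, $\mu$ its Riemannian volume measure normalized so that $\mu(\mathcal M)=1$. $\{u_\ell\}_{\ell\ge0}$ is an orthonormal basis of $L^2(\mu)$ with $-\Delta_{\mathcal M}u_\ell=\lambda_\ell^2u_\ell$ ($\Delta_{\mathcal M}$ the Laplace--Beltrami operator), $0=\lambda_0\le\lambda_1\le\cdots\to\infty$; $\widehat f_\ell=\int f\overline{u_\ell}\,d\mu$; $\mathbb P_n=\operatorname{span}\{u_\ell:\lambda_\ell\le n\}$. Generators $\Psi=\{\alpha;\beta^1,\ldots,\beta^r\}\subset L_1(\mathbb R)$, $\widehat h(\xi)=\int_{\mathbb R}h(t)e^{-2\pi it\xi}dt$, with the supports of $\widehat\alpha,\widehat{\beta^k}$ intersected with $[0,\infty)$ contained in $[0,1]$; filter bank $\Theta=\{a;b^1,\ldots,b^r\}\subset\ell_1(\mathbb Z)$ with symbols $\widehat a(\xi)=\sum_ma_me^{-2\pi im\xi}$, $\widehat{b^k}(\xi)=\sum_mb^k_me^{-2\pi im\xi}$. It is assumed that $\tau_\alpha:=\max\{\tau>0:\widehat\alpha(\xi)=1\text{ for }0\le\xi\le\tau\}$ exists and is $>0$, and $q_\alpha:=\min\{q\in\mathbb N_0:2^{-q}\le\tau_\alpha\}$. For $j\ge J$, $\Lambda_j^\alpha=\{\ell\ge0:\widehat\alpha(\lambda_\ell/2^j)\ne0\}$ (a finite set), and it is assumed that $\Lambda_{j-1}^\alpha\subset\Lambda_j^\alpha$.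 $\boldsymbol X_j\subset\boldsymbol X_{j+1}\subset\mathcal M$ are nested finite node sets with positive weights $w_{j,x}$, and $\mathbf F_j:\mathbb C^{\Lambda_j^\alpha}\to\mathbb C^{\boldsymbol X_j}$, $(\mathbf F_j\widehat{\mathbf z})(x)=\sum_{\ell\in\Lambda_j^\alpha}z_\ell w_{j,x}^{1/2}u_\ell(x)$. For $K>J$ the analysis operator $\mathcal A_{J,K}:\mathbb C^{\Lambda_K^\alpha}\to\mathbb C^{\boldsymbol X_J}\times\prod_{j=J+1}^K(\mathbb C^{\boldsymbol X_j})^r$ is defined as follows. Given $\widehat{\mathbf v}_K$, for $j=K,K-1,\ldots,J+1$ set $\widehat w^k_{j-1,\ell}=\widehat v_{j,\ell}\overline{\widehat{b^k}(\lambda_\ell/2^j)}$ ($\ell\in\Lambda_j^\alpha$), $\mathbf w^k_{j-1}=\mathbf F_j\widehat{\mathbf w}^k_{j-1}$, $\widehat v_{j-1,\ell}=\widehat v_{j,\ell}\overline{\widehat a(\lambda_\ell/2^j)}$ ($\ell\in\Lambda_{j-1}^\alpha$); then $\mathbf v_J=\mathbf F_J\widehat{\mathbf v}_J$ and $\mathcal A_{J,K}\widehat{\mathbf v}_K=(\mathbf v_J,\{\mathbf w^k_{j-1}\}_{J<j\le K,\,1\le k\le r})$. All coefficient spaces carry Euclidean inner products. By definition of $q_\alpha$, $\widehat\alpha(\lambda_\ell/2^{K_\alpha})=1$ whenever $\lambda_\ell\le2^L$, so $\{\ell:\lambda_\ell\le2^L\}\subset\Lambda_{K_\alpha}^\alpha$.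 For $P\in\mathbb P_{2^L}$ let $\widehat{\mathbf P}^{K_\alpha}\in\mathbb C^{\Lambda_{K_\alpha}^\alpha}$ be the vector of Fourier coefficients of $P$ (zero at indices with $\lambda_\ell>2^L$), and set $\mathcal B_{J,L}P:=\mathcal A_{J,K_\alpha}\widehat{\mathbf P}^{K_\alpha}$. Its adjoint (with respect to the $L^2(\mu)$ inner product on $\mathbb P_{2^L}$ and the Euclidean inner product) is $\mathcal B_{J,L}^*\mathbf c=\sum_{\lambda_\ell\le2^L}(\mathcal A_{J,K_\alpha}^*\mathbf c)_\ell u_\ell$. *)

(* Defs.v *)
From HB Require Import structures.
From mathcomp Require Import all_boot all_order all_algebra finmap.
From mathcomp Require Import complex.
From mathcomp Require Import all_classical all_reals all_analysis.

Set Implicit Arguments.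
Unset Strict Implicit.
Unset Printing Implicit Defensive.

Import Order.TTheory GRing.Theory Num.Theory.
Import numFieldNormedType.Exports.
Import Normc.

Local Open Scope classical_set_scope.
Local Open Scope ring_scope.
Local Open Scope complex_scope.

Section Euclidean.
Variables (R : realType) (d : nat).

Definition partial (a : 'I_d) (F : 'rV[R]_d -> R) (y : 'rV[R]_d) : R :=
  'D_(delta_mx 0 a) F y.

(* [V] is meant to be open: values of [F] outside [V] then play no role. *)
Fixpoint Ck (k : nat) (V : set 'rV[R]_d) (F : 'rV[R]_d -> R) : Prop :=
  (forall y, V y -> {for y, continuous F}) /\
  if k is k'.+1 then
    forall a : 'I_d,
      (forall y, V y -> derivable F y (delta_mx 0 a)) /\ Ck k' V (partial a F)
  else True.

Definition smooth_on (V : set 'rV[R]_d) (F : 'rV[R]_d -> R) : Prop :=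
  forall k, Ck k V F.

(* Row [a] is the [a]-th partial derivative of [T]. *)
Definition jacobi (T : 'rV[R]_d -> 'rV[R]_d) (y : 'rV[R]_d) : 'M[R]_d :=
  \matrix_(a, c) partial a (fun z => T z 0 c) y.

(* |g|^{-1/2} sum_a d_a (|g|^{1/2} sum_b g^{ab} d_b F) *)
Definition laplace_beltrami (g : 'rV[R]_d -> 'M[R]_d) (F : 'rV[R]_d -> R)
    (y : 'rV[R]_d) : R :=
  (Num.sqrt (\det (g y)))^-1 *
  \sum_a partial a (fun z => Num.sqrt (\det (g z)) *
                      \sum_b invmx (g z) a b * partial b F z) y.

End Euclidean.

(* The integral of a nonnegative Borel function against d-dimensional Lebesgue
   measure, written (Tonelli) as an iterated one-dimensional integral. *)
Fixpoint lebesgue_integral_rV (R : realType) (d : nat) :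
    ('rV[R]_d -> \bar R) -> \bar R :=
  match d with
  | 0 => fun F => F 0
  | d'.+1 => fun F => (\int[lebesgue_measure]_(t in [set: R])
      lebesgue_integral_rV
        (fun y : 'rV[R]_d' => F (row_mx (t%:M : 'rV[R]_1) y)))%E
  end.

(* A smooth Riemannian structure of dimension [d], without boundary: an atlas of
   charts [phi i : dom i -> R^d] with inverses [psi i], and in each chart the
   matrix of the metric.  Values of [phi i] off [dom i], and of [psi i] and
   [metric i] off [phi i @` dom i], are irrelevant. *)
Record riemannian (R : realType) (d : nat) (M : ptopologicalType) := Riemannian {
  chart : Type;
  dom : chart -> set M;
  phi : chart -> M -> 'rV[R]_d;
  psi : chart -> 'rV[R]_d -> M;
  metric : chart -> 'rV[R]_d -> 'M[R]_d;
  riemannian_hausdorff : hausdorff_space M;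
  riemannian_second_countable : @second_countable M;
  dom_open : forall i, open (dom i);
  dom_cover : forall x, exists i, dom i x;
  codom_open : forall i, open (phi i @` dom i);
  phiK : forall i x, dom i x -> psi i (phi i x) = x;
  phi_continuous : forall i x, dom i x -> {for x, continuous (phi i)};
  psi_continuous : forall i y, (phi i @` dom i) y ->
    {for y, continuous (psi i)};
  transition_smooth : forall i j a,
    smooth_on (phi i @` (dom i `&` dom j)) (fun y => phi j (psi i y) 0 a);
  metric_smooth : forall i a b,
    smooth_on (phi i @` dom i) (fun y => metric i y a b);
  metric_sym : forall i y, (phi i @` dom i) y -> (metric i y)^T = metric i y;
  metric_pos : forall i y, (phi i @` dom i) y ->
    forall v : 'rV[R]_d, v != 0 -> 0 < (v *m metric i y *m v^T) 0 0;
  metric_compat : forall i j y, (phi i @` (dom i `&` dom j)) y ->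
    let T := phi j \o psi i in
    metric i y = jacobi T y *m metric j (T y) *m (jacobi T y)^T
}.

Notation Borel M := (g_sigma_algebraType (@open M)).

(* The volume measure has density sqrt |g| in every chart, and [mu] is a
   multiple of it; for a probability measure the constant is 1 / vol(M). *)
Definition normalized_volume (R : realType) (d : nat) (M : ptopologicalType)
    (g : riemannian R d M) (mu : probability (Borel M) R) : Prop :=
  exists2 c : R, 0 < c &
  forall (i : chart g) (A : set (Borel M)), measurable A -> A `<=` dom i ->
    mu A = (c%:E * lebesgue_integral_rV
      ((fun y => (Num.sqrt (\det (metric i y)))%:E) \_ (phi i @` A)))%E.

Definition smooth_fun (R : realType) (d : nat) (M : ptopologicalType)
    (g : riemannian R d M) (u : M -> R[i]) : Prop :=
  forall i : chart g,
    smooth_on (phi i @` dom i) (fun y => complex.Re (u (psi i y))) /\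
    smooth_on (phi i @` dom i) (fun y => complex.Im (u (psi i y))).

(* - Delta u = s u for real s, with Delta acting on real and imaginary parts *)
Definition laplace_eigenfun (R : realType) (d : nat) (M : ptopologicalType)
    (g : riemannian R d M) (u : M -> R[i]) (s : R) : Prop :=
  forall (i : chart g) y, (phi i @` dom i) y ->
    - laplace_beltrami (metric i) (fun z => complex.Re (u (psi i z))) y
      = s * complex.Re (u (psi i y)) /\
    - laplace_beltrami (metric i) (fun z => complex.Im (u (psi i z))) y
      = s * complex.Im (u (psi i y)).

Section Integration.
Context {disp : measure_display} {T : measurableType disp} {R : realType}.
Variable mu : {measure set T -> \bar R}.
Implicit Types f g : T -> R[i].

Definition cintegral f : R[i] :=
  (\int[mu]_x complex.Re (f x)) +i* (\int[mu]_x complex.Im (f x)).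

Definition memL1 f : Prop :=
  mu.-integrable setT (fun x => (complex.Re (f x))%:E) /\
  mu.-integrable setT (fun x => (complex.Im (f x))%:E).

Definition memL2 f : Prop :=
  [/\ measurable_fun setT (fun x => complex.Re (f x)),
      measurable_fun setT (fun x => complex.Im (f x)) &
      (Lnorm mu 2%:E (fun x => (normc (f x))%:E) < +oo)%E].

Definition L2norm f : R := fine (Lnorm mu 2%:E (fun x => (normc (f x))%:E)).

Definition L2dot f g : R[i] := cintegral (fun x => f x * conjc (g x)).

Definition orthonormal_basis (u : nat -> T -> R[i]) : Prop :=
  [/\ forall l, memL2 (u l),
      forall l m, L2dot (u l) (u m) = (l == m)%:R &
      forall f, memL2 f ->
        L2norm (fun x => f x - \sum_(l < n) L2dot f (u l) * u l x)
          @[n --> \oo] --> (0 : R)].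

End Integration.

Section Fourier.
Variable R : realType.

Definition expi (t : R) : R[i] := cos t +i* sin t.

Definition fourier (h : R -> R[i]) (xi : R) : R[i] :=
  cintegral lebesgue_measure (fun t : R => h t * expi (- (2 * pi * t * xi))).

Definition summableZ (a : int -> R[i]) : Prop :=
  summable [set: int] (fun m => (normc (a m))%:E).

(* The sum over Z of a summable family, as a limit of symmetric partial sums. *)
Definition sumZ (a : int -> R[i]) : R[i] :=
  limn (fun n : nat => \sum_(k < n.*2.+1) complex.Re (a (k%:Z - n%:Z))) +i*
  limn (fun n : nat => \sum_(k < n.*2.+1) complex.Im (a (k%:Z - n%:Z))).

Definition symbol (a : int -> R[i]) (xi : R) : R[i] :=
  sumZ (fun m => a m * expi (- (2 * pi * m%:~R * xi))).

Definition supp_in_unit (h : R -> R[i]) : Prop :=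
  closure [set xi | fourier h xi != 0] `&` [set xi | 0 <= xi] `<=` `[0, 1].

Definition is_tau (alpha : R -> R[i]) (tau : R) : Prop :=
  let S := [set t : R | 0 < t /\
              forall xi, 0 <= xi <= t -> fourier alpha xi = 1] in
  S tau /\ ubound S tau.

Definition is_q (tau : R) (q : nat) : Prop :=
  2 ^- q <= tau /\ forall q' : nat, 2 ^- q' <= tau -> (q <= q')%N.

End Fourier.

Section Coefficients.
Variable R : realType.

Definition edot (I : finType) (v w : {ffun I -> R[i]}) : R[i] :=
  \sum_i v i * conjc (w i).

Definition enorm (I : finType) (v : {ffun I -> R[i]}) : R :=
  Num.sqrt (\sum_i normc (v i) ^+ 2).

(* conjugate transpose of the matrix of [A] *)
Definition adjoint (I N : finType) (A : {ffun I -> R[i]} -> {ffun N -> R[i]})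
    (c : {ffun N -> R[i]}) : {ffun I -> R[i]} :=
  [ffun l => edot c (A [ffun m => (m == l)%:R])].

Definition pointwise_linear (I N : finType)
    (A : {ffun I -> R[i]} -> {ffun N -> R[i]}) : Prop :=
  forall (k : R[i]) (v w : {ffun I -> R[i]}) n,
    A [ffun l => k * v l + w l] n = k * A v n + A w n.

Lemma adjointE (I N : finType) (A : {ffun I -> R[i]} -> {ffun N -> R[i]}) v c :
  pointwise_linear A -> edot (A v) c = edot v (adjoint A c).
Proof.
move=> linA.
pose delta l : {ffun I -> R[i]} := [ffun m => (m == l)%:R].
have A0 n : A [ffun=> 0] n = 0.
  have := linA (-1) [ffun=> 0] [ffun=> 0] n.
  have -> : [ffun l : I => -1 * ([ffun=> 0] : {ffun I -> R[i]}) l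
    + ([ffun=> 0] : {ffun I -> R[i]}) l] = [ffun=> 0] :> {ffun I -> R[i]}.
    by apply/ffunP => l; rewrite !ffunE mulr0 addr0.
  by rewrite mulN1r addNr.
have Asum n (s : seq I) :
    A [ffun m => \sum_(l <- s) v l * delta l m] n
    = \sum_(l <- s) v l * A (delta l) n.
  elim: s => [|l s IHs].
    rewrite big_nil -[RHS](A0 n); congr (A _ n).
    by apply/ffunP => m; rewrite !ffunE big_nil.
  rewrite big_cons -IHs -linA; congr (A _ n).
  by apply/ffunP => m; rewrite !ffunE big_cons ffunE.
have vE : v = [ffun m => \sum_l v l * delta l m].
  apply/ffunP => m; rewrite ffunE (bigD1 m) //= ffunE eqxx mulr1 big1 ?addr0//.
  by move=> l lm; rewrite ffunE eq_sym (negbTE lm) mulr0.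
have AvE n : A v n = \sum_l v l * A (delta l) n by rewrite -Asum -vE.
rewrite /edot.
under eq_bigr => n _ do rewrite AvE mulr_suml.
rewrite exchange_big /=; apply: eq_bigr => l _.
rewrite ffunE /edot rmorph_sum mulr_sumr; apply: eq_bigr => n _.
by rewrite rmorphM /= conjcK -mulrA; congr (_ * _); rewrite mulrC.
Qed.

(* extension by zero of a vector indexed by [S] *)
Definition ext (S : {fset nat}) (v : {ffun S -> R[i]}) (l : nat) : R[i] :=
  if insub l is Some l' then v l' else 0.

End Coefficients.

(* Index set of C^{X_J} x prod_{j = J+1}^{K} (C^{X_j})^r; the [i]-th
   block, 0 <= i < K - J, is j = J + i + 1. *)
Definition node_index (M : choiceType) (r : nat) (X : nat -> {fset M})
    (J K : nat) : finType :=
  (X J + {i : 'I_(K - J) & 'I_r * X (J + i).+1})%type.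

Section Analysis.
Variables (R : realType) (M : ptopologicalType).
Variables (u : nat -> M -> R[i]) (lambda : nat -> R).
Variables (alpha : R -> R[i]).
Variables (r : nat) (a : int -> R[i]) (b : 'I_r -> int -> R[i]).
Variables (X : nat -> {fset M}) (w : nat -> M -> R).

Definition Lambda_set (j : nat) : set nat :=
  [set l | fourier alpha (lambda l / 2 ^+ j) != 0].

(* [fset_set] of an infinite set is empty, but [Lambda_set j] and [low_set n]
   below are finite when [supp_in_unit alpha] and [lambda] tends to infinity. *)
Definition Lambda (j : nat) : {fset nat} := fset_set (Lambda_set j).

Definition Fop (j : nat) (z : {ffun Lambda j -> R[i]}) : {ffun X j -> R[i]} :=
  [ffun x => \sum_l z l * (Num.sqrt (w j (val x)))%:C * u (val l) (val x)].

(* \hat v_{K - m} as a function on nat vanishing off Lambda_{K - m} *)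
Fixpoint vhat (K : nat) (v : {ffun Lambda K -> R[i]}) (m : nat) : nat -> R[i] :=
  if m is m'.+1 then fun l =>
    if l \in Lambda (K - m) then
      vhat v m' l * conjc (symbol a (lambda l / 2 ^+ (K - m')))
    else 0
  else ext v.

Definition lowpass (J K : nat) (v : {ffun Lambda K -> R[i]}) :
    {ffun X J -> R[i]} :=
  Fop [ffun l : Lambda J => vhat v (K - J) (val l)].

Definition highpass (j K : nat) (k : 'I_r) (v : {ffun Lambda K -> R[i]}) :
    {ffun X j -> R[i]} :=
  Fop [ffun l : Lambda j => vhat v (K - j) (val l) *
         conjc (symbol (b k) (lambda (val l) / 2 ^+ j))].

Definition analysis (J K : nat) (v : {ffun Lambda K -> R[i]}) :
    {ffun node_index r X J K -> R[i]} :=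
  [ffun n : node_index r X J K =>
     match n with
     | inl x => lowpass J v x
     | inr (existT i (k, x)) => highpass (J + i).+1 k v x
     end].

Lemma vhat_linear K m (k : R[i]) (v v' : {ffun Lambda K -> R[i]}) l :
  vhat [ffun l => k * v l + v' l] m l = k * vhat v m l + vhat v' m l.
Proof.
elim: m l => [|m IHm] l /=.
  by rewrite /ext; case: insubP => [l' _ _|_]; rewrite ?ffunE // mulr0 addr0.
case: ifP => _; last by rewrite mulr0 addr0.
by rewrite IHm mulrDl mulrA.
Qed.

Lemma lowpass_linear J K (k : R[i]) (v v' : {ffun Lambda K -> R[i]}) x :
  lowpass J [ffun l => k * v l + v' l] x = k * lowpass J v x + lowpass J v' x.
Proof.
rewrite /lowpass /Fop [LHS]ffunE [X in k * X]ffunE [X in _ + X]ffunE.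
rewrite mulr_sumr -big_split; apply: eq_bigr => l _ /=.
rewrite [X in X * _ * _ = _]ffunE [X in k * (X * _ * _)]ffunE.
by rewrite [X in _ + X * _ * _]ffunE vhat_linear !mulrDl !mulrA.
Qed.

Lemma highpass_linear j K m (k : R[i]) (v v' : {ffun Lambda K -> R[i]}) x :
  highpass j m [ffun l => k * v l + v' l] x
  = k * highpass j m v x + highpass j m v' x.
Proof.
rewrite /highpass /Fop [LHS]ffunE [X in k * X]ffunE [X in _ + X]ffunE.
rewrite mulr_sumr -big_split; apply: eq_bigr => l _ /=.
rewrite [X in X * _ * _ = _]ffunE [X in k * (X * _ * _)]ffunE.
by rewrite [X in _ + X * _ * _]ffunE vhat_linear !mulrDl !mulrA.
Qed.

Lemma analysis_linear J K : pointwise_linear (@analysis J K).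
Proof.
move=> k v v' n; rewrite /analysis [LHS]ffunE [X in k * X]ffunE.
rewrite [X in _ + X]ffunE; case: n => [x|[i [m x]]].
  exact: lowpass_linear.
exact: highpass_linear.
Qed.

Definition low_set (n : R) : set nat := [set l | lambda l <= n].

Lemma low_set_finite n : lambda m @[m --> \oo] --> +oo -> finite_set (low_set n).
Proof.
move=> /cvgryPgt /(_ n) [N _ HN].
apply: (sub_finite_set _ (finite_II N)) => l /= ln.
by rewrite ltnNge; apply/negP => /HN /=; rewrite ltNge ln.
Qed.

Lemma Lambda_set_finite j :
  supp_in_unit alpha -> (forall l, 0 <= lambda l) ->
  lambda m @[m --> \oo] --> +oo -> finite_set (Lambda_set j).
Proof.
move=> supp l0 /(low_set_finite (2 ^+ j)); apply: sub_finite_set => l /= nz.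
have p2 : 0 < 2 ^+ j :> R by rewrite exprn_gt0.
have : (`[0, 1]%classic : set R) (lambda l / 2 ^+ j).
  by apply: supp; split => /=; [exact: subset_closure | rewrite divr_ge0 // ltW].
by rewrite /= in_itv /= ler_pdivrMr // mul1r => /andP[].
Qed.

Definition polyspace (n : R) : set (M -> R[i]) :=
  [set P | exists (s : seq nat) (c : nat -> R[i]),
     (forall l, l \in s -> low_set n l) /\
     P = (fun x => \sum_(l <- s) c l * u l x)].

Variable mu : {measure set (Borel M) -> \bar R}.

Definition coef (f : M -> R[i]) (l : nat) : R[i] :=
  L2dot mu (f : Borel M -> R[i]) (u l).

Definition projection (n : R) (f : M -> R[i]) : M -> R[i] :=
  fun x => \sum_(l <- fset_set (low_set n)) coef f l * u l x.

Definition restricted_analysis (J L K : nat) (P : M -> R[i]) :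
    {ffun node_index r X J K -> R[i]} :=
  analysis J [ffun l : Lambda K =>
    if lambda (val l) <= 2 ^+ L then coef P (val l) else 0].

Definition restricted_adjoint (J L K : nat)
    (c : {ffun node_index r X J K -> R[i]}) : M -> R[i] :=
  fun x => \sum_(l <- fset_set (low_set (2 ^+ L)))
             ext (adjoint (@analysis J K) c) l * u l x.

End Analysis.

Arguments restricted_analysis {R M} u lambda alpha {r} a b X w mu J L K P.
Arguments restricted_adjoint {R M} u lambda alpha {r} a b X w J L K c _.

Definition is_argmin (T : Type) (R : realType) (S : set T) (F : T -> R)
    (x : T) : Prop :=
  S x /\ forall y, S y -> F x <= F y.

(* Main.v *)
Require Import Defs.
From HB Require Import structures.
From mathcomp Require Import all_boot all_order all_algebra finmap.
From mathcomp Require Import complex.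
From mathcomp Require Import all_classical all_reals all_analysis measurable_realfun.
From mathcomp Require Import ring lra.

Set Implicit Arguments.
Unset Strict Implicit.
Unset Printing Implicit Defensive.

Import Order.TTheory GRing.Theory Num.Theory.
Import numFieldNormedType.Exports.

Local Open Scope classical_set_scope.
Local Open Scope ring_scope.
Local Open Scope complex_scope.
(* The frame bounds say that the form <Ap, Aq> - <p, q> on coefficient vectors is
   at most eps |p|^2 on the diagonal; being Hermitian, it has operator norm at most
   eps, so |A* A p - p| <= eps |p|, and |A* e| <= sqrt (1 + eps) |e| by duality.
   The least-squares solution v of c = A p + e solves A* A v = A* c, so A (v - p)
   is the orthogonal projection of e onto the range of A, whence
   sqrt (1 - eps) |v - p| <= |A (v - p)| <= |e|.  Since q_alpha was chosen so that
   { l | lambda l <= 2^L } lies in Lambda_K, coefficient vectors indexed by that set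
   are isometric to P_{2^L} and B is A in these coordinates; finally f - f_L is
   orthogonal to P_{2^L}. *)

Lemma normc_sqr (R : rcfType) (z : R[i]) :
  Normc.normc z ^+ 2 = complex.Re z ^+ 2 + complex.Im z ^+ 2.
Proof. by case: z => x y /=; rewrite sqr_sqrtr // addr_ge0 // sqr_ge0. Qed.

(** * Real Euclidean geometry of complex coefficient vectors *)

Section FiniteFrames.
Variable R : realType.

Definition real_comb (I : finType) (t : R) (v w : {ffun I -> R[i]}) :
  {ffun I -> R[i]} := [ffun i => t%:C * v i + w i].

(** The real part of the Hermitian product gives the same norm and still satisfies the adjoint
    relation, so the frame arguments can be carried out in a real inner product space, without
    phases. *)
Definition real_dot (I : finType) (v w : {ffun I -> R[i]}) : R :=
  complex.Re (edot v w).

Lemma real_dotE (I : finType) (v w : {ffun I -> R[i]}) :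
  real_dot v w = \sum_i (complex.Re (v i) * complex.Re (w i)
                         + complex.Im (v i) * complex.Im (w i)).
Proof.
rewrite /real_dot /edot raddf_sum; apply: eq_bigr => i _.
by case: (v i) (w i) => [x y] [x' y'] /=; rewrite mulrN opprK.
Qed.

Lemma real_dotC (I : finType) (v w : {ffun I -> R[i]}) :
  real_dot v w = real_dot w v.
Proof. by rewrite !real_dotE; apply: eq_bigr => i _; congr (_ + _); rewrite mulrC. Qed.

Lemma real_dot_comb (I : finType) t (v w x : {ffun I -> R[i]}) :
  real_dot (real_comb t v w) x = t * real_dot v x + real_dot w x.
Proof.
rewrite !real_dotE mulr_sumr -big_split; apply: eq_bigr => i _ /=.
by rewrite ffunE; case: (v i) (w i) (x i) => [? ?] [? ?] [? ?] /=; ring.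
Qed.

Lemma enorm_sqr (I : finType) (v : {ffun I -> R[i]}) :
  enorm v ^+ 2 = real_dot v v.
Proof.
rewrite sqr_sqrtr; last by apply: sumr_ge0 => i _; exact: sqr_ge0.
by rewrite real_dotE; apply: eq_bigr => i _; rewrite normc_sqr !expr2.
Qed.

Lemma enorm_ge0 (I : finType) (v : {ffun I -> R[i]}) : 0 <= enorm v.
Proof. exact: sqrtr_ge0. Qed.

Lemma real_dot_ge0 (I : finType) (v : {ffun I -> R[i]}) : 0 <= real_dot v v.
Proof. by rewrite -enorm_sqr sqr_ge0. Qed.

Lemma real_dot_eq0 (I : finType) (v : {ffun I -> R[i]}) :
  real_dot v v = 0 -> v = 0.
Proof.
rewrite -enorm_sqr sqr_sqrtr; last by apply: sumr_ge0 => i _; exact: sqr_ge0.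
move=> /eqP; rewrite psumr_eq0; last by move=> i _; exact: sqr_ge0.
move=> /allP v0; apply/ffunP => i; rewrite ffunE.
have /implyP/(_ isT) := v0 i (mem_index_enum i).
by rewrite sqrf_eq0 => /eqP/Normc.eq0_normc.
Qed.

Lemma real_combB (I : finType) (v w : {ffun I -> R[i]}) :
  v - w = real_comb (-1) w v.
Proof.
by apply/ffunP => i; rewrite !ffunE rmorphN rmorph1 mulN1r addrC.
Qed.

Lemma real_combD (I : finType) (v w : {ffun I -> R[i]}) :
  v + w = real_comb 1 v w.
Proof. by apply/ffunP => i; rewrite !ffunE rmorph1 mul1r. Qed.

Lemma sqr_real_comb (I : finType) t (v w : {ffun I -> R[i]}) :
  real_dot (real_comb t v w) (real_comb t v w)
  = t ^+ 2 * real_dot v v + t *+ 2 * real_dot v w + real_dot w w.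
Proof.
rewrite real_dot_comb (real_dotC v) (real_dotC w) !real_dot_comb (real_dotC w v).
by ring.
Qed.

(** Cauchy-Schwarz: with s = |v|, t = |w| and h = <v, w>, the squared norm of w - (t / s) v is 2 (t
    / s) (s t - h). The factor t / s vanishes when w = 0, so that case is separate. *)
Lemma real_dot_le (I : finType) (v w : {ffun I -> R[i]}) :
  real_dot v w <= enorm v * enorm w.
Proof.
have [v0|v0] := eqVneq v 0.
  rewrite v0 real_dotE big1 ?mulr_ge0 ?enorm_ge0// => i _.
  by rewrite !ffunE /= !mul0r addr0.
have sv : 0 < enorm v.
  rewrite lt_def enorm_ge0 andbT; apply: contra v0 => /eqP nv.
  by apply/eqP/real_dot_eq0; rewrite -enorm_sqr nv expr0n.
have := real_dot_ge0 (real_comb (- (enorm w / enorm v)) v w).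
rewrite sqr_real_comb -!enorm_sqr.
set s := enorm v in sv *; set t := enorm w; set h := real_dot v w.
have -> : (- (t / s)) ^+ 2 * s ^+ 2 + (- (t / s)) *+ 2 * h + t ^+ 2
   = 2 * (t / s) * (s * t - h) by field; rewrite gt_eqF.
have : 0 <= t by exact: enorm_ge0.
rewrite le_eqVlt => /predU1P[t0|t0].
  suff -> : h = 0 by move=> _; rewrite mulr_ge0 ?enorm_ge0.
  have w0 : w = 0 by apply: real_dot_eq0; rewrite -enorm_sqr -/t -t0 expr0n.
  by rewrite /h w0 real_dotE big1// => i _; rewrite !ffunE /= !mulr0 addr0.
by rewrite pmulr_rge0 ?subr_ge0// mulr_gt0// divr_gt0.
Qed.

Lemma enormD (I : finType) (v w : {ffun I -> R[i]}) :
  enorm (v + w) <= enorm v + enorm w.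
Proof.
rewrite -(ler_pXn2r (ltn0Sn 1)) ?nnegrE ?addr_ge0 ?enorm_ge0//.
rewrite enorm_sqr real_combD sqr_real_comb -!enorm_sqr expr1n mul1r sqrrD.
by rewrite lerD2r lerD2l mulr_natl ler_pMn2r ?real_dot_le.
Qed.

(** * Linear maps with frame bounds: near-identity, adjoint bound, least squares *)

Section Frame.
Variables (I N : finType) (A : {ffun I -> R[i]} -> {ffun N -> R[i]}).
Hypothesis linA : pointwise_linear A.

Lemma map_real_comb t v w : A (real_comb t v w) = real_comb t (A v) (A w).
Proof. by apply/ffunP => n; rewrite linA [RHS]ffunE. Qed.

Lemma pointwise_linearB v w : A (v - w) = A v - A w.
Proof. by rewrite !real_combB map_real_comb. Qed.

Lemma real_dot_adjoint v c : real_dot (A v) c = real_dot v (adjoint A c).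
Proof. by rewrite /real_dot adjointE. Qed.

Lemma adjoint_linear : pointwise_linear (adjoint A).
Proof.
move=> k v w i; rewrite !ffunE /edot mulr_sumr -big_split /=.
by apply: eq_bigr => n _; rewrite ffunE mulrDl mulrA.
Qed.

Variable eps : R.
Hypotheses (eps_ge0 : 0 <= eps) (eps_lt1 : eps < 1).
Hypothesis frameA : forall v,
  (1 - eps) * enorm v ^+ 2 <= enorm (A v) ^+ 2 <= (1 + eps) * enorm v ^+ 2.

(* Polarizing the form <Av, Aw> - <v, w>, which is at most eps |v|^2 on the
   diagonal, at [x +/- t z] with [z = A* A x - x] gives
   2 t |z|^2 <= eps (|x|^2 + t^2 |z|^2); take t = 1 / eps. *)
Lemma frame_operator_near_id x : enorm (adjoint A (A x) - x) <= eps * enorm x.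
Proof.
set z := _ - x.
(* The form at (z, x) is <z, A* A x - x>, which is |z|^2 by the choice of z. *)
have hz : real_dot (A z) (A x) - real_dot z x = real_dot z z.
  have -> : real_dot z z = real_dot (real_comb (-1) x (adjoint A (A x))) z.
    by rewrite -real_combB.
  rewrite real_dot_comb real_dot_adjoint (real_dotC x) (real_dotC _ z).
  by ring.
have key t : t *+ 2 * real_dot z z <= eps * (real_dot x x + t ^+ 2 * real_dot z z).
  have /andP[_] := frameA (real_comb t z x).
  have /andP[+ _] := frameA (real_comb (- t) z x).
  rewrite !map_real_comb !enorm_sqr !sqr_real_comb.
  move: hz; set Azx := real_dot (A z) (A x); set zx := real_dot z x.
  set zz := real_dot z z; set xx := real_dot x x; move=> hz h1 h2.
  rewrite -hz; rewrite -hz in h1 h2; nra.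
rewrite -(ler_pXn2r (ltn0Sn 1)) ?nnegrE ?mulr_ge0 ?enorm_ge0// exprMn !enorm_sqr.
(* The choice t = 1 / eps needs eps nonzero; for eps = 0 the bound at t = 1 already reads 2 |z|^2 <=
   0. *)
have [e0|e0] := eqVneq eps 0.
  by have := key 1; rewrite e0; have := real_dot_ge0 z; lra.
have e1 : 0 < eps by rewrite lt_def e0.
have : eps * (eps^-1 *+ 2 * real_dot z z)
    <= eps * (eps * (real_dot x x + eps^-1 ^+ 2 * real_dot z z)).
  by rewrite ler_pM2l.
have -> : eps * (eps^-1 *+ 2 * real_dot z z) = 2 * real_dot z z by field.
have -> : eps * (eps * (real_dot x x + eps^-1 ^+ 2 * real_dot z z))
  = eps ^+ 2 * real_dot x x + real_dot z z by field.
lra.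
Qed.

(** With y = A* c, |y|^2 = <A y, c> <= |A y| |c| <= sqrt (1 + eps) |y| |c|; one factor |y|
    cancels. *)
Lemma enorm_adjoint_le c : enorm (adjoint A c) <= Num.sqrt (1 + eps) * enorm c.
Proof.
set y := adjoint A c.
have [y0|y0] := eqVneq (enorm y) 0.
  by rewrite y0 mulr_ge0 ?sqrtr_ge0 ?enorm_ge0.
have py : 0 < enorm y by rewrite lt_def y0 enorm_ge0.
rewrite -(ler_pM2l py) -expr2 enorm_sqr {2}/y -real_dot_adjoint.
apply: (le_trans (real_dot_le _ _)).
rewrite mulrA ler_wpM2r ?enorm_ge0//.
rewrite -(ler_pXn2r (ltn0Sn 1)) ?nnegrE ?mulr_ge0 ?sqrtr_ge0 ?enorm_ge0//.
rewrite exprMn [X in _ * X]sqr_sqrtr ?addr_ge0// mulrC.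
by have /andP[] := frameA y.
Qed.

Lemma one_pass_error p e :
  enorm (adjoint A (A p + e) - p)
  <= eps * enorm p + Num.sqrt (1 + eps) * enorm e.
Proof.
have -> : adjoint A (A p + e) - p = (adjoint A (A p) - p) + adjoint A e.
  apply/ffunP => i; rewrite [in LHS]ffunE.
  have -> : A p + e = [ffun n => 1 * A p n + e n].
    by apply/ffunP => n; rewrite !ffunE mul1r.
  by rewrite adjoint_linear mul1r !ffunE addrAC.
apply: (le_trans (enormD _ _)).
by rewrite lerD ?frame_operator_near_id ?enorm_adjoint_le.
Qed.

(** The lower frame constant 1 - eps is positive. Solvability of the normal equation and uniqueness
    of the minimizer both rest on this. *)
Lemma frame_injective v : A v = 0 -> v = 0.
Proof.
move=> Av; have /andP[+ _] := frameA v; rewrite Av !enorm_sqr.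
have -> : real_dot (0 : {ffun N -> R[i]}) 0 = 0.
  by rewrite real_dotE big1// => i _; rewrite !ffunE /= !mulr0 addr0.
rewrite pmulr_rle0 ?subr_gt0// => le0; apply: real_dot_eq0; apply/eqP.
by rewrite eq_le le0 real_dot_ge0.
Qed.

(** A* A v = 0 gives |A v|^2 = <v, A* A v> = 0, hence v = 0; an injective endomorphism of a
    finite-dimensional space is onto. *)
Lemma normal_equation c : exists v, adjoint A (A v) = adjoint A c.
Proof.
(* [R[i]^o] is the field as a module over itself, which makes the coefficient vectors a
   finite-dimensional vector space. *)
pose T (v : {ffun I -> R[i]^o}) : {ffun I -> R[i]^o} := adjoint A (A v).
have linT : linear T.
  move=> k v w; apply/ffunP => i; rewrite [RHS]ffunE [X in _ = X + _]ffunE.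
  rewrite /T.
  have -> : A (k *: v + w) = [ffun n => k * A v n + A w n].
    apply/ffunP => n; rewrite ffunE -linA; congr (A _ n).
    by apply/ffunP => j; rewrite !ffunE.
  by rewrite adjoint_linear.
pose T' : {linear _ -> _} :=
  HB.pack T (GRing.isLinear.Build _ _ _ _ T linT).
have kerT : lker (linfun T') == 0%VS.
  apply/lker0P => v w; rewrite !lfunE /= => Tvw.
  apply/eqP; rewrite -subr_eq0; apply/eqP.
  apply: frame_injective; apply: real_dot_eq0.
  rewrite real_dot_adjoint.
  have -> : adjoint A (A (v - w)) = 0.
    have := raddfB T' v w; rewrite /= Tvw subrr; exact.
  by rewrite real_dotE big1// => i _; rewrite !ffunE /= !mulr0 addr0.
have : (adjoint A c : {ffun I -> R[i]^o}) \in limg (linfun T').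
  by rewrite lker0_limgf// memvf.
by move=> /memv_imgP[v _ ->]; exists v; rewrite lfunE.
Qed.

(* Pythagoras: [A v - c] is the sum of [A (v - v0)] and the residual [A v0 - c],
   which is orthogonal to the range of [A]. *)
Lemma least_squares_split v0 c v : adjoint A (A v0) = adjoint A c ->
  enorm (A v - c) ^+ 2 = enorm (A (v - v0)) ^+ 2 + enorm (A v0 - c) ^+ 2.
Proof.
move=> v0E.
have orth : real_dot (A (v - v0)) (A v0 - c) = 0.
  rewrite real_dotC (real_combB (A v0)) real_dot_comb.
  by rewrite 2!(real_dotC _ (A (v - v0))) !real_dot_adjoint v0E; ring.
have -> : A v - c = real_comb 1 (A (v - v0)) (A v0 - c).
  by rewrite -real_combD pointwise_linearB addrA subrK.
by rewrite !enorm_sqr sqr_real_comb orth; ring.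
Qed.

(** By the Pythagorean split, a residual no larger than that of [v0] forces |A (v - v0)|^2 <= 0, and
    A is injective. *)
Lemma least_squares_unique v0 c v : adjoint A (A v0) = adjoint A c ->
  enorm (A v - c) ^+ 2 <= enorm (A v0 - c) ^+ 2 -> v = v0.
Proof.
move=> v0E; rewrite (least_squares_split _ v0E) gerDr enorm_sqr => le0.
apply/eqP; rewrite -subr_eq0; apply/eqP/frame_injective/real_dot_eq0/eqP.
by rewrite eq_le le0 real_dot_ge0.
Qed.

Lemma least_squares_error p e v0 :
  adjoint A (A v0) = adjoint A (A p + e) ->
  enorm (v0 - p) <= (Num.sqrt (1 - eps))^-1 * enorm e.
Proof.
move=> v0E; have e1 : 0 < Num.sqrt (1 - eps) by rewrite sqrtr_gt0 subr_gt0.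
rewrite mulrC ler_pdivlMr// mulrC.
(* With y = v0 - p, moving A across the product and using the normal equation gives <A y, A y> = <A
   y, e>; then Cauchy-Schwarz. *)
have Ae : enorm (A (v0 - p)) ^+ 2 <= enorm (A (v0 - p)) * enorm e.
  apply: le_trans (real_dot_le _ _); rewrite enorm_sqr.
  rewrite {2}pointwise_linearB (real_combB (A v0)) real_dotC real_dot_comb.
  rewrite 2!(real_dotC _ (A (v0 - p))) (real_dot_adjoint _ (A v0)) v0E.
  rewrite -real_dot_adjoint (real_combD (A p)) (real_dotC _ (real_comb _ _ _)).
  by rewrite real_dot_comb !(real_dotC _ (A (v0 - p))); lra.
have {}Ae : enorm (A (v0 - p)) <= enorm e.
  have [->|n0] := eqVneq (enorm (A (v0 - p))) 0; first exact: enorm_ge0.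
  have n1 : 0 < enorm (A (v0 - p)) by rewrite lt_def n0 enorm_ge0.
  by rewrite -(ler_pM2l n1) -expr2.
apply: le_trans Ae.
rewrite -(ler_pXn2r (ltn0Sn 1)) ?nnegrE ?mulr_ge0 ?sqrtr_ge0 ?enorm_ge0//.
rewrite exprMn [X in X * _]sqr_sqrtr ?subr_ge0 ?(ltW eps_lt1)//.
by have /andP[] := frameA (v0 - p).
Qed.

End Frame.
End FiniteFrames.

(** * Square-integrable complex functions and their inner product *)

Section ComplexL2.
Context {disp : measure_display} {T : measurableType disp} {R : realType}.
Variable mu : {measure set T -> \bar R}.
Implicit Types f g h : T -> R[i].

Local Notation "'re' f" := (fun x => complex.Re (f x)) (at level 10).
Local Notation "'im' f" := (fun x => complex.Im (f x)) (at level 10).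

(** This holds in the extended reals for every f, so finiteness of the norm can be traded for
    integrability of |f|^2. *)
Lemma Lnorm2_sqr f :
  (Lnorm mu 2%:E (fun x => (Normc.normc (f x))%:E) `^ 2
   = \int[mu]_x (complex.Re (f x) ^+ 2 + complex.Im (f x) ^+ 2)%:E)%E.
Proof.
rewrite poweR_Lnorm//; apply: eq_integral => x _.
by rewrite /= powR_mulrn ?normr_ge0// real_normK ?num_real// normc_sqr.
Qed.

Lemma measurable_sqr_normc f : measurable_fun setT (re f) ->
  measurable_fun setT (im f) ->
  measurable_fun setT (fun x => complex.Re (f x) ^+ 2 + complex.Im (f x) ^+ 2).
Proof.
by move=> mr mi; apply: measurable_funD; apply: measurable_funX.
Qed.

Lemma memL2P f : memL2 mu f <->
  [/\ measurable_fun setT (re f), measurable_fun setT (im f) &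
  mu.-integrable setT
    (fun x => (complex.Re (f x) ^+ 2 + complex.Im (f x) ^+ 2)%:E)].
Proof.
have pos x : 0 <= complex.Re (f x) ^+ 2 + complex.Im (f x) ^+ 2.
  by rewrite addr_ge0 ?sqr_ge0.
split=> -[mr mi fin]; split=> //.
- apply/integrableP; split.
    by apply/measurable_EFinP; exact: measurable_sqr_normc.
  under eq_integral => x _ do rewrite abse_EFin ger0_norm//.
  by rewrite -Lnorm2_sqr poweR_lty.
(* A norm equal to +oo would have an infinite square, against the integrability of |f|^2. *)
- have := Lnorm2_sqr f; have /integrableP[_] := fin.
  under eq_integral => x _ do rewrite abse_EFin ger0_norm//.
  move=> + E; rewrite -E.
  have := Lnorm_ge0 mu 2%:E (fun x => (Normc.normc (f x))%:E).
  by case: (Lnorm _ _ _) => [s| |]//; rewrite ?ltry// poweRyr.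
Qed.

Lemma L2norm_ge0 f : 0 <= L2norm mu f.
Proof. by rewrite /L2norm fine_ge0// Lnorm_ge0. Qed.

Lemma sqr_L2norm f : memL2 mu f -> L2norm mu f ^+ 2
  = (\int[mu]_x (complex.Re (f x) ^+ 2 + complex.Im (f x) ^+ 2)).
Proof.
move=> [_ _ fin]; rewrite /Rintegral -Lnorm2_sqr /L2norm.
have := Lnorm_ge0 mu 2%:E (fun x => (Normc.normc (f x))%:E).
move: fin; case: (Lnorm _ _ _) => [s| |]//= _ s0.
by rewrite powR_mulrn.
Qed.

Lemma memL2_comb k f g : memL2 mu f -> memL2 mu g ->
  memL2 mu (fun x => k * f x + g x).
Proof.
move=> /memL2P[frm fim fi] /memL2P[grm gim gi].
have mr : measurable_fun setT (re (fun x => k * f x + g x)).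
  have -> : re (fun x => k * f x + g x) = (fun x => complex.Re k * complex.Re (f x)
     - complex.Im k * complex.Im (f x) + complex.Re (g x)).
    by apply/funext => x; case: k (f x) (g x) => ? ? [? ?] [? ?].
  apply: measurable_funD => //; apply: measurable_funB;
    by apply: measurable_funM => //; exact: measurable_cst.
have mi : measurable_fun setT (im (fun x => k * f x + g x)).
  have -> : im (fun x => k * f x + g x) = (fun x => complex.Re k * complex.Im (f x)
     + complex.Im k * complex.Re (f x) + complex.Im (g x)).
    by clear mr; apply/funext => x; case: k (f x) (g x) => ? ? [? ?] [? ?].
  apply: measurable_funD => //; apply: measurable_funD;
    by apply: measurable_funM => //; exact: measurable_cst.
apply/memL2P; split=> //.
(* Here s = |k|^2, and |k f + g|^2 is dominated by 2 |k|^2 |f|^2 + 2 |g|^2. The slack is |k f -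
   g|^2, whose two squares are supplied to [nra] at the end. *)
pose s := complex.Re k ^+ 2 + complex.Im k ^+ 2.
have ik := integrableD measurableT (integrableZl measurableT (2 * s) fi)
   (integrableZl measurableT 2 gi).
apply: le_integrable ik => //.
  by apply/measurable_EFinP; exact: measurable_sqr_normc.
have sq2 (y z : R) : 0 <= y ^+ 2 + z ^+ 2 by rewrite addr_ge0 ?sqr_ge0.
move=> x _.
change ((`|complex.Re (k * f x + g x) ^+ 2 + complex.Im (k * f x + g x) ^+ 2|%:E
  <= `|2 * s * (complex.Re (f x) ^+ 2 + complex.Im (f x) ^+ 2)
       + 2 * (complex.Re (g x) ^+ 2 + complex.Im (g x) ^+ 2)|%:E)%E).
rewrite lee_fin !ger0_norm//; last first.
  by rewrite addr_ge0 ?(mulr_ge0 _ (sq2 _ _))// mulr_ge0.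
rewrite /s; clear mr mi s; case: k (f x) (g x) => p q [x1 x2] [y1 y2] /=.
have := sqr_ge0 (p * x1 - q * x2 - y1).
have := sqr_ge0 (p * x2 + q * x1 - y2).
nra.
Qed.

(** The real and imaginary parts of the product are each dominated pointwise by |f|^2 + |g|^2, by
    expanding squares of sums and differences. *)
Lemma memL1_L2dot f g : memL2 mu f -> memL2 mu g ->
  memL1 mu (fun x => f x * conjc (g x)).
Proof.
move=> /memL2P[frm fim fi] /memL2P[grm gim gi].
have ik := integrableD measurableT fi gi.
have dom (h : T -> R) : measurable_fun setT h -> (forall x, `|h x| <=
    (complex.Re (f x) ^+ 2 + complex.Im (f x) ^+ 2)
    + (complex.Re (g x) ^+ 2 + complex.Im (g x) ^+ 2)) ->
  mu.-integrable setT (EFin \o h).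
  move=> mh hle; apply: le_integrable ik => //; first exact/measurable_EFinP.
  move=> x _; change ((`|h x|%:E
    <= `|(complex.Re (f x) ^+ 2 + complex.Im (f x) ^+ 2)
         + (complex.Re (g x) ^+ 2 + complex.Im (g x) ^+ 2)|%:E)%E).
  by rewrite lee_fin [leRHS]ger0_norm ?addr_ge0 ?sqr_ge0.
split; apply: dom.
- have -> : re (fun x => f x * conjc (g x)) = (fun x =>
    complex.Re (f x) * complex.Re (g x) + complex.Im (f x) * complex.Im (g x)).
    by apply/funext => x; case: (f x) (g x) => [? ?] [? ?] /=; ring.
  by apply: measurable_funD; exact: measurable_funM.
- move=> x; case: (f x) (g x) => [x1 x2] [y1 y2] /=; rewrite ler_norml.
  have := (sqr_ge0 (x1 + y1), sqr_ge0 (x1 - y1), sqr_ge0 (x2 + y2),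
           sqr_ge0 (x2 - y2), sqr_ge0 x1, sqr_ge0 x2, sqr_ge0 y1, sqr_ge0 y2).
  by case=> [[[[[[[? ?] ?] ?] ?] ?] ?] ?]; apply/andP; split; nra.
- have -> : im (fun x => f x * conjc (g x)) = (fun x =>
    complex.Im (f x) * complex.Re (g x) - complex.Re (f x) * complex.Im (g x)).
    by apply/funext => x; case: (f x) (g x) => [? ?] [? ?] /=; ring.
  by apply: measurable_funB; exact: measurable_funM.
- move=> x; case: (f x) (g x) => [x1 x2] [y1 y2] /=; rewrite ler_norml.
  have := (sqr_ge0 (x1 + y2), sqr_ge0 (x1 - y2), sqr_ge0 (x2 + y1),
           sqr_ge0 (x2 - y1), sqr_ge0 x1, sqr_ge0 x2, sqr_ge0 y1, sqr_ge0 y2).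
  by case=> [[[[[[[? ?] ?] ?] ?] ?] ?] ?]; apply/andP; split; nra.
Qed.

Lemma cintegral_comb k f g : memL1 mu f -> memL1 mu g ->
  cintegral mu (fun x => k * f x + g x) = k * cintegral mu f + cintegral mu g.
Proof.
move=> [fr fi] [gr gi]; case: k => p q; rewrite /cintegral.
have iM (s : R) (h : T -> R) : mu.-integrable setT (EFin \o h) ->
  mu.-integrable setT (EFin \o (fun x => s * h x)).
  by move=> ih; exact: (integrableZl measurableT s ih).
have iD (h1 h2 : T -> R) : mu.-integrable setT (EFin \o h1) ->
  mu.-integrable setT (EFin \o h2) ->
  mu.-integrable setT (EFin \o (fun x => h1 x + h2 x)).
  by move=> i1 i2; exact: (integrableD measurableT i1 i2).
apply/eqP; rewrite eq_complex /=; apply/andP; split; apply/eqP.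
- under eq_Rintegral => x _.
    have -> : complex.Re ((p +i* q) * f x + g x) = p * complex.Re (f x)
      + - q * complex.Im (f x) + complex.Re (g x).
      by case: (f x) (g x) => [? ?] [? ?] /=; rewrite mulNr.
    over.
  rewrite RintegralD//; last by apply: iD; exact: iM.
  rewrite RintegralD//; [|exact: iM..].
  by rewrite !RintegralZl// mulNr.
- under eq_Rintegral => x _.
    have -> : complex.Im ((p +i* q) * f x + g x) = p * complex.Im (f x)
      + q * complex.Re (f x) + complex.Im (g x).
      by case: (f x) (g x) => [? ?] [? ?].
    over.
  rewrite RintegralD//; last by apply: iD; exact: iM.
  rewrite RintegralD//; [|exact: iM..].
  by rewrite !RintegralZl.
Qed.

Lemma L2dot_comb k f g h : memL2 mu f -> memL2 mu g -> memL2 mu h ->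
  L2dot mu (fun x => k * f x + g x) h = k * L2dot mu f h + L2dot mu g h.
Proof.
move=> f2 g2 h2; rewrite -cintegral_comb; [|exact: memL1_L2dot..].
by congr cintegral; apply/funext => x; rewrite mulrDl mulrA.
Qed.

Lemma L2dot_conj f g : memL2 mu f -> memL2 mu g ->
  L2dot mu g f = conjc (L2dot mu f g).
Proof.
move=> f2 g2; have [_ i2] := memL1_L2dot f2 g2.
rewrite /L2dot /cintegral /=; congr (_ +i* _).
  by apply: eq_Rintegral => x _; case: (f x) (g x) => [? ?] [? ?] /=; ring.
rewrite -mulN1r -RintegralZl//.
by apply: eq_Rintegral => x _; case: (f x) (g x) => [? ?] [? ?] /=; ring.
Qed.

Lemma sqr_L2norm_dot f : memL2 mu f ->
  L2norm mu f ^+ 2 = complex.Re (L2dot mu f f).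
Proof.
move=> f2; rewrite sqr_L2norm//; apply: eq_Rintegral => x _ /=.
by case: (f x) => ? ? /=; ring.
Qed.

(** Orthogonality gives |f - g|^2 = |f|^2 + |g|^2 <= (|f| + |g|)^2, so no Cauchy-Schwarz inequality
    for integrals is involved. *)
Lemma L2norm_sub_orth f g : memL2 mu f -> memL2 mu g -> L2dot mu f g = 0 ->
  L2norm mu (fun x => f x - g x) <= L2norm mu f + L2norm mu g.
Proof.
move=> f2 g2 fg0.
have gf0 : L2dot mu g f = 0 by rewrite L2dot_conj// fg0 conjc0.
have -> : (fun x => f x - g x) = (fun x => -1 * g x + f x).
  by apply/funext => x; rewrite mulN1r addrC.
have h2 := memL2_comb (-1) g2 f2.
rewrite -(ler_pXn2r (ltn0Sn 1)) ?nnegrE ?addr_ge0 ?L2norm_ge0//.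
rewrite sqrrD sqr_L2norm_dot// L2dot_comb//.
rewrite (L2dot_conj h2 g2) (L2dot_conj h2 f2) !L2dot_comb// fg0 gf0.
rewrite !sqr_L2norm_dot//.
set a := L2dot mu f f; set b := L2dot mu g g.
have -> : complex.Re (-1 * (-1 * b + 0)^* + (-1 * 0 + a)^*)%C
  = complex.Re a + complex.Re b.
  by case: a b => [? ?] [? ?] /=; ring.
by rewrite lerD2r lerDl mulrn_wge0// mulr_ge0// L2norm_ge0.
Qed.

End ComplexL2.

(** * Synthesis from a finite orthonormal system *)

Section OrthonormalSystem.
Context {disp : measure_display} {T : measurableType disp} {R : realType}.
Variable mu : {measure set T -> \bar R}.
Variables (I : finType) (v : I -> T -> R[i]).
Hypothesis v_L2 : forall i, memL2 mu (v i).
Hypothesis v_orth : forall i j, L2dot mu (v i) (v j) = (i == j)%:R.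

Definition synthesis (p : {ffun I -> R[i]}) : T -> R[i] :=
  fun x => \sum_i p i * v i x.

Lemma memL2_cst0 : memL2 mu (fun=> 0 : R[i]).
Proof.
apply/memL2P; split; [exact: measurable_cst..|].
rewrite /= expr0n addr0; exact: integrable0.
Qed.

Lemma memL2_sum (s : seq I) (c : I -> R[i]) :
  memL2 mu (fun x => \sum_(i <- s) c i * v i x).
Proof.
elim: s => [|i s IHs].
  by under eq_fun do rewrite big_nil; exact: memL2_cst0.
by under eq_fun do rewrite big_cons; exact: memL2_comb.
Qed.

Lemma L2dot_sum (s : seq I) (c : I -> R[i]) h : memL2 mu h ->
  L2dot mu (fun x => \sum_(i <- s) c i * v i x) h
  = \sum_(i <- s) c i * L2dot mu (v i) h.
Proof.
move=> h2; elim: s => [|i s IHs]; last first.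
  rewrite big_cons -IHs -L2dot_comb//; last exact: memL2_sum.
  by congr L2dot; apply/funext => x; rewrite big_cons.
rewrite big_nil; under eq_fun do rewrite big_nil.
(* Writing 0 as -1 * 0 + 0 yields <0, h> = - <0, h> + <0, h> = 0. *)
have := L2dot_comb (-1) memL2_cst0 memL2_cst0 h2.
by under eq_fun do rewrite mulr0 addr0; rewrite mulN1r addNr.
Qed.

Lemma memL2_synthesis p : memL2 mu (synthesis p).
Proof. exact: memL2_sum. Qed.

Lemma L2dot_synthesis p i : L2dot mu (synthesis p) (v i) = p i.
Proof.
rewrite L2dot_sum// (bigD1 i)//= v_orth eqxx mulr1 big1 ?addr0// => j ji.
by rewrite v_orth (negbTE ji) mulr0.
Qed.

(** Parseval for a finite system; this isometry carries the coefficient estimates over to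
    functions. *)
Lemma L2norm_synthesis p : L2norm mu (synthesis p) = enorm p.
Proof.
have p2 := memL2_synthesis p.
apply/eqP; rewrite -(eqrXn2 (ltn0Sn 1)) ?L2norm_ge0 ?enorm_ge0//; apply/eqP.
rewrite sqr_L2norm_dot// enorm_sqr /real_dot L2dot_sum//; congr complex.Re.
apply: eq_bigr => i _; congr (_ * _).
by rewrite (L2dot_conj p2)// L2dot_synthesis.
Qed.

Variables (f : T -> R[i]) (p : {ffun I -> R[i]}).
Hypothesis f_L2 : memL2 mu f.
Hypothesis pE : forall i, p i = L2dot mu f (v i).

(** As p holds the coefficients of f, the tail f - [synthesis p] is orthogonal to the span. The
    error of any p' thus splits into this tail and the coefficient error p' - p; both
    reconstructions are estimated this way. *)
Lemma L2norm_synthesis_sub p' : L2norm mu (synthesis p' \- f)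
  <= L2norm mu (f \- synthesis p) + enorm (p' - p).
Proof.
have gE : f \- synthesis p = (fun x => -1 * synthesis p x + f x).
  by apply/funext => x /=; rewrite mulN1r addrC.
have g2 : memL2 mu (f \- synthesis p).
  by rewrite gE; apply: memL2_comb => //; exact: memL2_synthesis.
have -> : synthesis p' \- f
    = (fun x => synthesis (p' - p) x - (f \- synthesis p) x).
  apply/funext => x /=.
  have -> : synthesis (p' - p) x = synthesis p' x - synthesis p x.
    by rewrite /synthesis -sumrB; apply: eq_bigr => i _; rewrite !ffunE mulrBl.
  by rewrite opprB addrA subrK.
rewrite [leRHS]addrC -[enorm _]L2norm_synthesis; apply: L2norm_sub_orth => //.
  exact: memL2_synthesis.
rewrite L2dot_sum// big1// => i _; rewrite L2dot_conj// gE L2dot_comb//; last first.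
  exact: memL2_synthesis.
by rewrite L2dot_synthesis -pE mulN1r addNr conjc0 mulr0.
Qed.

End OrthonormalSystem.

(** * Change of index set for coefficient vectors *)

Lemma ext_linear (R : realType) (S : {fset nat}) k (v w : {ffun S -> R[i]}) l :
  ext [ffun i => k * v i + w i] l = k * ext v l + ext w l.
Proof.
by rewrite /ext; case: insubP => [l' _ _|_]; rewrite ?ffunE // mulr0 addr0.
Qed.

Lemma ext_val (R : realType) (S : {fset nat}) (v : {ffun S -> R[i]}) (l : S) :
  ext v (val l) = v l.
Proof. by rewrite /ext valK. Qed.

Lemma ext_notin (R : realType) (S : {fset nat}) (v : {ffun S -> R[i]}) l :
  l \notin S -> ext v l = 0.
Proof. by move=> lS; rewrite /ext insubN. Qed.

(** Extension by zero when S is contained in S', as in its use below; in general, entries at indices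
    outside S' are dropped. *)
Definition embed (R : realType) (S S' : {fset nat}) (v : {ffun S -> R[i]}) :
  {ffun S' -> R[i]} := [ffun l => ext v (val l)].

Lemma embed_linear (R : realType) (S S' : {fset nat}) k (v w : {ffun S -> R[i]}) :
  embed S' [ffun i => k * v i + w i]
  = [ffun l => k * embed S' v l + embed S' w l].
Proof. by apply/ffunP => l; rewrite !ffunE ext_linear. Qed.

(** The list s may repeat indices, as [polyspace] allows, so the coefficient at l collects every
    occurrence of l in s. *)
Lemma sum_fset_ffun (R : realType) (S : {fset nat}) (c : nat -> R[i])
    (F : nat -> R[i]) (s : seq nat) : {subset s <= S} ->
  \sum_(m <- s) c m * F m
  = \sum_(l : S)
      ([ffun l => \sum_(m <- s) (val l == m)%:R * c m] : {ffun S -> R[i]}) l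
        * F (val l).
Proof.
move=> sS; under [RHS]eq_bigr => l _ do rewrite ffunE mulr_suml.
rewrite exchange_big /=; apply: eq_big_seq => m ms.
rewrite (bigD1 [` sS m ms]%fset)//= eqxx mul1r big1 ?addr0// => l lm.
case: eqP => [vl|_]; last by rewrite !mul0r.
by case/eqP: lm; apply: val_inj.
Qed.

(** * Transfer of the frame estimates to the reconstruction of f *)

Theorem theorem6p1
  (R : realType)
  (d : nat) (M : ptopologicalType) (g : riemannian R d M)
  (M_compact : compact [set: M]) (M_connected : connected [set: M])
  (mu : probability (Borel M) R) (mu_volume : normalized_volume g mu)
  (u : nat -> M -> R[i]) (lambda : nat -> R)
  (u_smooth : forall l, smooth_fun g (u l))
  (u_eigen : forall l, laplace_eigenfun g (u l) (lambda l ^+ 2))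
  (u_basis : orthonormal_basis mu (u : nat -> Borel M -> R[i]))
  (lambda0 : lambda 0%N = 0)
  (lambda_nondecreasing : forall l, lambda l <= lambda l.+1)
  (lambda_infty : lambda l @[l --> \oo] --> +oo)
  (r : nat) (alpha : R -> R[i]) (beta : 'I_r -> R -> R[i])
  (alpha_L1 : memL1 lebesgue_measure alpha)
  (beta_L1 : forall k, memL1 lebesgue_measure (beta k))
  (alpha_supp : supp_in_unit alpha)
  (beta_supp : forall k, supp_in_unit (beta k))
  (a : int -> R[i]) (b : 'I_r -> int -> R[i])
  (a_l1 : summableZ a) (b_l1 : forall k, summableZ (b k))
  (tau : R) (tau_alpha : is_tau alpha tau)
  (q : nat) (q_alpha : is_q tau q)
  (J0 J L : nat) (J0_J : (J0 <= J)%N) (J_K : (J < L + q)%N)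
  (Lambda_nested : forall j, (J <= j)%N ->
     Lambda_set lambda alpha j `<=` Lambda_set lambda alpha j.+1)
  (X : nat -> {fset M}) (w : nat -> M -> R)
  (X_nested : forall j, (J <= j)%N -> fsubset (X j) (X j.+1))
  (w_pos : forall j x, (J <= j)%N -> x \in X j -> 0 < w j x)
  (eps : R) (eps_ge0 : 0 <= eps) (eps_lt1 : eps < 1)
  (f : M -> R[i]) (f_L2 : memL2 mu (f : Borel M -> R[i]))
  (e : {ffun node_index r X J (L + q) -> R[i]}) :
  let norm := fun h : M -> R[i] => L2norm mu (h : Borel M -> R[i]) in
  let PL := polyspace u lambda (2 ^+ L) in
  let B := restricted_analysis u lambda alpha a b X w mu J L (L + q) in
  let Bstar := restricted_adjoint u lambda alpha a b X w J L (L + q) in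
  (forall P, PL P ->
     (1 - eps) * norm P ^+ 2 <= enorm (B P) ^+ 2 <= (1 + eps) * norm P ^+ 2) ->
  let fL := projection u lambda mu (2 ^+ L) f in
  let c := B fL + e in
  let ftilde := Bstar c in
  let argmin := is_argmin PL (fun P => enorm (B P - c) ^+ 2) in
  norm (ftilde \- f) <=
    norm (f \- fL) + eps * norm fL + Num.sqrt (1 + eps) * enorm e /\
  (exists! uL, argmin uL) /\
  (forall uL, argmin uL ->
     norm (uL \- f) <= norm (f \- fL) + (Num.sqrt (1 - eps))^-1 * enorm e).
Proof.

move=> norm PL B Bstar frame fL c ftilde argmin.
pose S : {fset nat} := fset_set (low_set lambda (2 ^+ L)).
pose K := (L + q)%N.
have memS l : (l \in S) = (lambda l <= 2 ^+ L).
  rewrite in_fset_set; last exact: low_set_finite.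
  by apply/idP/idP; rewrite inE.
have lambda_ge0 l : 0 <= lambda l.
  by elim: l => [|l IHl]; [rewrite lambda0 | exact: le_trans (lambda_nondecreasing l)].
(* Since K = L + q, lambda l <= 2^L gives lambda l / 2^K <= 2^-q <= tau, where the Fourier transform
   of alpha equals 1. *)
have S_Lambda l : l \in S -> l \in Lambda lambda alpha K.
  rewrite memS => lL; rewrite in_fset_set; last exact: Lambda_set_finite.
  rewrite inE /Lambda_set /=.
  have [[_ tau1] _] := tau_alpha; have [q_tau _] := q_alpha.
  rewrite tau1 ?oner_neq0// divr_ge0 ?exprn_ge0//=.
  apply: le_trans q_tau; rewrite /K exprD invfM mulrA ler_piMl ?invr_ge0 ?exprn_ge0//.
  by rewrite ler_pdivrMr ?exprn_gt0// mul1r.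
pose v (l : S) : Borel M -> R[i] := u (val l).
have [u_L2 u_orth _] := u_basis.
have v_L2 l : memL2 mu (v l) by exact: u_L2.
have v_orth l m : L2dot mu (v l) (v m) = (l == m)%:R by rewrite u_orth.
(* The frame bounds are given on P_{2^L} only, so the coordinates of A run over S and not over all
   of [Lambda] at level K. *)
pose A (p : {ffun S -> R[i]}) : {ffun node_index r X J K -> R[i]} :=
  @analysis R M u lambda alpha r a b X w J K (embed (Lambda lambda alpha K) p).
have linA : pointwise_linear A.
  by move=> k p p' n; rewrite /A embed_linear analysis_linear.
have BE p : B (synthesis v p) = A p.
  rewrite /B /restricted_analysis /A; congr analysis; apply/ffunP => l.
  rewrite !ffunE -memS; case: ifPn => lS; last by rewrite ext_notin.
  rewrite -[val l]/(val [` lS]%fset) ext_val.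
  exact: (L2dot_synthesis v_L2 v_orth).
have PL_synthesis p : PL (synthesis v p).
  exists (enum_fset S), (ext p); split=> [l lS|]; first by rewrite /low_set /= -memS.
  apply/funext => x; rewrite big_seq_fsetE /=; apply: eq_bigr => l _.
  by rewrite ext_val.
have PLP P : PL P -> exists p, P = synthesis v p.
  move=> [s [z [sL ->]]].
  eexists; apply/funext => x; apply: (sum_fset_ffun (S := S) z (fun l => u l x)).
  by move=> l /sL; rewrite memS.
have frameA p : (1 - eps) * enorm p ^+ 2 <= enorm (A p) ^+ 2
    <= (1 + eps) * enorm p ^+ 2.
  by have := frame _ (PL_synthesis p); rewrite /norm (L2norm_synthesis v_L2 v_orth) BE.
pose p : {ffun S -> R[i]} := [ffun l => coef u mu f (val l)].
have pE l : p l = L2dot mu (f : Borel M -> R[i]) (v l) by rewrite ffunE.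
have fLE : fL = synthesis v p.
  apply/funext => x; rewrite /fL /projection big_seq_fsetE.
  by apply: eq_bigr => l _; rewrite ffunE.
have cE : c = A p + e by rewrite /c fLE BE.
(* [restricted_adjoint] cuts the adjoint of the full analysis map down to S. This is the adjoint of
   A because [embed] sends the unit vector at l to the unit vector at l. *)
have ftildeE : ftilde = synthesis v (adjoint A c).
  apply/funext => x; rewrite /ftilde /Bstar /restricted_adjoint big_seq_fsetE.
  apply: eq_bigr => l _ /=; congr (_ * _).
  have lK := S_Lambda _ (valP l).
  rewrite -[val l]/(val [` lK]%fset) ext_val !ffunE /A.
  congr (edot c (analysis _ _ _ _ _ _ _)).
  apply/ffunP => m; rewrite !ffunE /ext; case: insubP => [m' _ mm'|mS].
    by rewrite ffunE -!val_eqE /= mm'.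
  rewrite -val_eqE /=; case: eqP => // mE.
  by case/negP: mS; rewrite [val m]mE (valP l).
have err := L2norm_synthesis_sub v_L2 v_orth f_L2 pE.
have [p0 p0E] := normal_equation linA eps_lt1 frameA c.
(* Every competitor in P_{2^L} is a synthesis, so the Pythagorean split makes the solution [p0] of
   the normal equation the only minimizer. *)
have argminP P : argmin P <-> P = synthesis v p0.
  split=> [[PLP' minP]|->].
    have [p' PE] := PLP _ PLP'; rewrite PE; apply: (congr1 (synthesis v)).
    apply: (least_squares_unique linA eps_lt1 frameA p0E).
    by have := minP _ (PL_synthesis p0); rewrite PE !BE.
  split=> [|Q /PLP[p' ->]]; first exact: PL_synthesis.
  by rewrite !BE (least_squares_split linA p' p0E) lerDr sqr_ge0.
split; [|split].
- rewrite ftildeE fLE -addrA; apply: le_trans (err _) _.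
  rewrite lerD2l /norm (L2norm_synthesis v_L2 v_orth) cE.
  exact: one_pass_error.
- by exists (synthesis v p0); split=> [|P /argminP->//]; apply/argminP.
- move=> uL /argminP ->; rewrite fLE; apply: le_trans (err _) _.
  rewrite lerD2l; apply: (least_squares_error linA eps_lt1 frameA).
  by rewrite p0E cE.
Qed.
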